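(* Let $K$ be a Kripke structure and $t,t'$ two states of $K$. Then $t$ and $t'$ are indistinguishable by CTL+Sync formulas (i.e., for every CTL+Sync formula $\varphi$, $K,t\models\varphi$ iff $K,t'\models\varphi$) if and only if $t$ and $t'$ are bisimilar. The same equivalence holds for CTL+Sync extended with sequences of unary temporal operators.
   Context: A Kripke structure is $K=\langle T,\Pi,\pi,R\rangle$ with $T$ a finite set of states, $\Pi$ a finite set of atomic propositions, $\pi:T\to 2^{\Pi}$ a labeling, $R\subseteq T\times T$ a transition relation; $R(t)=\{t'\mid(t,t')\in R\}$. A path is an infinite sequence $t_0t_1\dots$ with $(t_i,t_{i+1})\in R$. Two states are bisimilar if they are related by some bisimulation, i.e. a relation $B\subseteq T\times T$ such that whenever $(u,v)\in B$: $\pi(u)=\pi(v)$, for every $u'\in R(u)$ there is $v'\in R(v)$ with $(u',v')\in B$, and for every $v'\in R(v)$ there is $u'\in R(u)$ with $(u',v')\in B$. CTL+Sync formulas: $\varphi ::= p \mid \neg\varphi_1 \mid \varphi_1\lor\varphi_2 \mid \exists\mathcal X\varphi_1 \mid \forall\mathcal X\varphi_1 \mid \varphi_1\,\exists\mathcal U\,\varphi_2 \mid \varphi_1\,\forall\mathcal U\,\varphi_2 \mid \varphi_1\,\mathcal U\exists\,\varphi_2 \mid \varphi_1\,\mathcal U\forall\,\varphi_2$, $p\in\Pi$, with semantics: standard for $p,\neg,\lor$; $\exists\mathcal X\varphi_1$ / $\forall\mathcal X\varphi_1$: some / every successor satisfies $\varphi_1$; $\varphi_1\exists\mathcal U\varphi_2$: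 some path from $t$ has a $k$ with $\varphi_2$ at position $k$ and $\varphi_1$ at all positions $j<k$; $\varphi_1\forall\mathcal U\varphi_2$: every path from $t$ has such a $k$; $\varphi_1\,\mathcal U\exists\,\varphi_2$: there exists $k\ge0$ such that for all $0\le j<k$ some path $t_0t_1\dots$ from $t$ has $K,t_j\models\varphi_1$ and $K,t_k\models\varphi_2$; $\varphi_1\,\mathcal U\forall\,\varphi_2$: there exists $k\ge0$ such that for all $0\le j<k$ and all paths $t_0t_1\dots$ from $t$, $K,t_j\models\varphi_1$ and $K,t_k\models\varphi_2$. The extension with sequences of unary temporal operators adds formulas $\mathcal T Q\varphi_1$ with $\mathcal T=O_1\cdots O_m\in\{F,G\}^+$, $Q\in\{\exists,\forall\}$, where $K,t\models O_1\cdots O_m Q\varphi_1$ iff $\mathsf Q_1 k_1\ge 0\ \mathsf Q_2 k_2\ge k_1\cdots \mathsf Q_m k_m\ge k_{m-1}$ such that for $Q$ (some/all) paths $t_0t_1\dots$ with $t_0=t$, $K,t_{k_m}\models\varphi_1$, with $\mathsf Q_i$ ''there exists'' if $O_i=F$ and ''for all'' if $O_i=G$.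
   Formalization: Assumes Π is nonempty or R is total: with Π empty there are no formulas, so a state with a successor and one without are indistinguishable but not bisimilar. In U∃ and U∀, φ2 is required at position k also when k = 0. *)

(* Defs.v *)
From HB Require Import structures.
From mathcomp Require Import all_boot.

Set Implicit Arguments.
Unset Strict Implicit.
Unset Printing Implicit Defensive.

(* Transitions are not required to be total: a state may have no successor. *)
Record kripke := Kripke {
  state :> finType;
  AP : finType;
  label : state -> {set AP};
  trans : rel state
}.

Arguments label {k} t : rename.
Arguments trans {k} t t' : rename.

Definition succs (K : kripke) (t : K) : {set K} := [set t' | trans t t'].

Definition path_from (K : kripke) (t : K) (w : nat -> K) : Prop :=
  w 0 = t /\ forall i, trans (w i) (w i.+1).

Definition bisimulation (K : kripke) (B : K -> K -> Prop) : Prop :=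
  forall u v, B u v ->
    [/\ label u = label v,
        forall u', u' \in succs u -> exists2 v', v' \in succs v & B u' v'
      & forall v', v' \in succs v -> exists2 u', u' \in succs u & B u' v'].

Definition bisimilar (K : kripke) (t t' : K) : Prop :=
  exists B : K -> K -> Prop, bisimulation B /\ B t t'.

Inductive tempop := Fop | Gop.

Inductive quant := Some_path | All_paths.

(* [form P ext] has the constructor [SeqQ] only if [ext] is true, so that
   [form P false] is exactly CTL+Sync. The nonempty operator sequence
   O_1 ... O_m is given by its head O_1 and its tail O_2 ... O_m. *)
Inductive form (P : Type) (ext : bool) : Type :=
| Atom of P
| Neg of form P ext
| Or of form P ext & form P ext
| EX of form P ext
| AX of form P ext
| EU of form P ext & form P ext
| AU of form P ext & form P ext
| UE of form P ext & form P ext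
| UA of form P ext & form P ext
| SeqQ of ext & tempop & seq tempop & quant & form P ext.

Notation CTLSync P := (form P false).
Notation CTLSyncSeq P := (form P true).

Definition quant_paths (K : kripke) (q : quant) (t : K)
    (A : (nat -> K) -> Prop) : Prop :=
  match q with
  | Some_path => exists w, path_from t w /\ A w
  | All_paths => forall w, path_from t w -> A w
  end.

(* [quant_pos [:: O_1; ...; O_m] k_0 A] is
   Q_1 k_1 >= k_0, ..., Q_m k_m >= k_(m-1), A k_m. *)
Fixpoint quant_pos (s : seq tempop) (k : nat) (A : nat -> Prop) : Prop :=
  match s with
  | [::] => A k
  | Fop :: s' => exists k', k <= k' /\ quant_pos s' k' A
  | Gop :: s' => forall k', k <= k' -> quant_pos s' k' A
  end.

(* In [UE] and [UA] the first conjunct only matters for k = 0: it keeps the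
   requirement on the second argument at position k when no j < k exists, and
   it is implied by the second conjunct when k > 0. In [UE] the path may
   depend on j. *)
Fixpoint sat (K : kripke) (ext : bool) (t : K) (phi : form (AP K) ext) : Prop :=
  match phi with
  | Atom p => p \in label t
  | Neg f => ~ sat t f
  | Or f g => sat t f \/ sat t g
  | EX f => exists t', t' \in succs t /\ sat t' f
  | AX f => forall t', t' \in succs t -> sat t' f
  | EU f g => quant_paths Some_path t (fun w =>
      exists k, sat (w k) g /\ forall j, j < k -> sat (w j) f)
  | AU f g => quant_paths All_paths t (fun w =>
      exists k, sat (w k) g /\ forall j, j < k -> sat (w j) f)
  | UE f g => exists k,
      quant_paths Some_path t (fun w => sat (w k) g) /\
      forall j, j < k ->
        quant_paths Some_path t (fun w => sat (w j) f /\ sat (w k) g)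
  | UA f g => exists k,
      quant_paths All_paths t (fun w => sat (w k) g) /\
      forall j, j < k ->
        quant_paths All_paths t (fun w => sat (w j) f /\ sat (w k) g)
  | SeqQ _ o s q f =>
      quant_pos (o :: s) 0 (fun k => quant_paths q t (fun w => sat (w k) f))
  end.

(* Main.v *)
Require Import Defs.
From Stdlib Require Import Classical ClassicalEpsilon.
From mathcomp Require Import all_boot.

Set Implicit Arguments.
Unset Strict Implicit.
Unset Printing Implicit Defensive.

(** Bisimilar states start pathwise bisimilar paths: a path is lifted step by
    step along the bisimulation. Every operator of the logic is invariant under
    such a lifting, so bisimilar states satisfy the same formulas. Conversely,
    as in the Hennessy-Milner theorem, logical indistinguishability is itself a
    bisimulation: if a successor [u'] of [u] were matched by no successor of
    [v], the finite conjunction of formulas separating [u'] from each successor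
    of [v], prefixed by [EX], would separate [u] from [v]. *)

Definition indistinguishable (K : kripke) (ext : bool) (u v : K) : Prop :=
  forall phi : form (AP K) ext, sat u phi <-> sat v phi.

Lemma indistinguishable_sym (K : kripke) ext (u v : K) :
  indistinguishable ext u v -> indistinguishable ext v u.
Proof. by move=> uv phi; split=> /uv. Qed.

Section Invariance.

Variable K : kripke.
Implicit Types (B : K -> K -> Prop) (u v : K) (w : nat -> K).

Lemma bisimulation_sym B :
  bisimulation B -> bisimulation (fun u v => B v u).
Proof. by move=> bisB u v /bisB [-> fwd bwd]; split. Qed.

Lemma bisimulation_path B u v w :
  bisimulation B -> B u v -> path_from u w ->
  exists2 w', path_from v w' & forall i, B (w i) (w' i).
Proof.
move=> bisB Buv [w0 wS].
(* Each point carries the proof that it is related to [w i], so that choosing a matching successor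
   becomes a function that recursion on [i] can iterate from [v]. *)
have next i (x : {x | B (w i) x}) :
    {y : {y | B (w i.+1) y} | trans (sval x) (sval y)}.
  apply: constructive_indefinite_description; case: x => x Bx /=.
  have [_ fwd _] := bisB _ _ Bx.
  have [|y] := fwd (w i.+1); first by rewrite inE.
  by rewrite inE => xy By; exists (exist _ y By).
have Bw0 : B (w 0) v by rewrite w0.
pose run := nat_rect (fun i => {x | B (w i) x}) (exist _ v Bw0)
  (fun i x => sval (next i x)).
exists (fun i => sval (run i)) => [|i]; last exact: svalP (run i).
by split=> // i; apply: svalP (next i (run i)).
Qed.

(** A witness path is lifted from the side where it is given; for a universal quantifier the
    arbitrary path is lifted back to the other side, along the converse bisimulation where
    necessary. *)
Lemma bisimulation_quant_paths B q u v (A A' : (nat -> K) -> Prop) :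
  bisimulation B -> B u v ->
  (forall w w', (forall i, B (w i) (w' i)) -> (A w <-> A' w')) ->
  quant_paths q u A <-> quant_paths q v A'.
Proof.
move=> bisB Buv AA'; have bisB' := bisimulation_sym bisB.
case: q => /=; split.
- move=> [w [uw Aw]]; have [w' vw' Bww'] := bisimulation_path bisB Buv uw.
  by exists w'; split=> //; apply/(AA' w).
- move=> [w' [vw' Aw']]; have [w uw Bww'] := bisimulation_path bisB' Buv vw'.
  by exists w; split=> //; apply/(AA' _ w').
- move=> uA w' vw'; have [w uw Bww'] := bisimulation_path bisB' Buv vw'.
  by apply/(AA' w) => //; apply: uA.
- move=> vA w uw; have [w' vw' Bww'] := bisimulation_path bisB Buv uw.
  by apply/(AA' _ w') => //; apply: vA.
Qed.

Lemma eq_quant_pos s k (A A' : nat -> Prop) :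
  (forall i, A i <-> A' i) -> quant_pos s k A <-> quant_pos s k A'.
Proof.
move=> AA'; elim: s k => [|[] s IH] k //=; split.
- by move=> [k' [kk' /IH Ak']]; exists k'.
- by move=> [k' [kk' /IH Ak']]; exists k'.
- by move=> Ak k' /Ak /IH.
- by move=> Ak k' /Ak /IH.
Qed.

Lemma bisimulation_indistinguishable B ext u v :
  bisimulation B -> B u v -> indistinguishable ext u v.
Proof.
move=> bisB Buv phi.
have untilP (f g : form (AP K) ext) : (forall u v, B u v -> (sat u f <-> sat v f)) ->
    (forall u v, B u v -> (sat u g <-> sat v g)) ->
    forall w w', (forall i, B (w i) (w' i)) ->
    ((exists k, sat (w k) g /\ forall j, j < k -> sat (w j) f) <->
     (exists k, sat (w' k) g /\ forall j, j < k -> sat (w' j) f)).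
  move=> If Ig w w' Bww'; split=> -[k [gk fk]]; exists k; split=> [|j /fk].
  - exact/(Ig _ _ (Bww' k)).
  - by move/(If _ _ (Bww' j)).
  - exact/(Ig _ _ (Bww' k)).
  - by move/(If _ _ (Bww' j)).
(* Lifting preserves positions, so the same [k] works on both sides, and for fixed [j] and [k] only
   one path quantifier has to be transferred. *)
have syncP q (f g : form (AP K) ext) : (forall u v, B u v -> (sat u f <-> sat v f)) ->
    (forall u v, B u v -> (sat u g <-> sat v g)) -> forall u v, B u v ->
    ((exists k, quant_paths q u (fun w => sat (w k) g) /\
       forall j, j < k ->
         quant_paths q u (fun w => sat (w j) f /\ sat (w k) g)) <->
     (exists k, quant_paths q v (fun w => sat (w k) g) /\
       forall j, j < k ->
         quant_paths q v (fun w => sat (w j) f /\ sat (w k) g))).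
  move=> If Ig {Buv}u {}v Buv.
  have Pg k : quant_paths q u (fun w => sat (w k) g) <->
              quant_paths q v (fun w => sat (w k) g).
    by apply: (bisimulation_quant_paths _ bisB Buv) => w w' Bww'; apply: Ig.
  have Pfg j k : quant_paths q u (fun w => sat (w j) f /\ sat (w k) g) <->
                 quant_paths q v (fun w => sat (w j) f /\ sat (w k) g).
    apply: (bisimulation_quant_paths _ bisB Buv) => w w' Bww'.
    by have := If _ _ (Bww' j); have := Ig _ _ (Bww' k); tauto.
  by split=> -[k [/Pg gk fgk]]; exists k; split=> // j /fgk /Pfg.
elim: phi u v Buv => [p|f If|f If g Ig|f If|f If|f If g Ig|f If g Ig
  |f If g Ig|f If g Ig|e o s q f If] u v Buv.
- by have [/= -> _ _] := bisB _ _ Buv.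
- by have /= := If _ _ Buv; tauto.
- by have /= := If _ _ Buv; have := Ig _ _ Buv; tauto.
- have [_ fwd bwd] := bisB _ _ Buv; split=> /= -[x [xS fx]].
    by have [y yS Bxy] := fwd _ xS; exists y; split=> //; apply/(If x).
  by have [y yS Byx] := bwd _ xS; exists y; split=> //; apply/(If y x).
- have [_ fwd bwd] := bisB _ _ Buv; split=> /= fS x xS.
    by have [y yS Byx] := bwd _ xS; apply/(If y) => //; apply: fS.
  by have [y yS Bxy] := fwd _ xS; apply/(If x y) => //; apply: fS.
- exact: (bisimulation_quant_paths Some_path bisB Buv (untilP _ _ If Ig)).
- exact: (bisimulation_quant_paths All_paths bisB Buv (untilP _ _ If Ig)).
- exact: (syncP Some_path _ _ If Ig).
- exact: (syncP All_paths _ _ If Ig).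
(* The position quantifiers range over numbers only, so it suffices to compare the two states at
   each fixed [k]. *)
- apply: eq_quant_pos => k; apply: (bisimulation_quant_paths _ bisB Buv).
  by move=> w w' Bww'; apply: If.
Qed.

End Invariance.

Section Characterization.

Variables (K : kripke) (ext : bool).
Implicit Types (u v x y : K) (phi : form (AP K) ext).

(** Closure under [Neg] allows the separating formula to be oriented so that it holds at [x]. *)
Lemma separating_formula x y :
  ~ indistinguishable ext x y -> exists phi, sat x phi /\ ~ sat y phi.
Proof.
move=> /not_all_ex_not [phi sep].
by case: (classic (sat x phi)) => xphi; [exists phi | exists (Neg phi)];
  rewrite /=; tauto.
Qed.

Lemma separating_formula_seq x (s : seq K) phi0 :
  (forall y, y \in s -> ~ indistinguishable ext x y) ->
  exists phi, sat x phi /\ forall y, y \in s -> ~ sat y phi.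
Proof.
elim: s => [|z s IH] sep.
  (* The syntax has no constant for truth; the empty conjunction is a tautology built from
     [phi0]. *)
  by exists (Or phi0 (Neg phi0)); split=> //=; apply: classic.
have [|phi [xphi sphi]] := IH.
  by move=> y ys; apply: sep; rewrite inE ys orbT.
have [|psi [xpsi zpsi]] := @separating_formula x z.
  by apply: sep; rewrite inE eqxx.
(* Conjunction of [phi] and [psi], by De Morgan. *)
exists (Neg (Or (Neg phi) (Neg psi))); split=> /=; first by tauto.
by move=> y; rewrite inE => /predU1P[->|/sphi]; tauto.
Qed.

(* Without atoms there is no formula at all, hence no [true] to serve as the
   empty conjunction when [v] is a dead end. *)
Lemma indistinguishable_succ u v x :
  (0 < #|AP K| \/ forall u : K, exists v : K, trans u v) ->
  indistinguishable ext u v -> x \in succs u ->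
  exists2 y, y \in succs v & indistinguishable ext x y.
Proof.
move=> hK uv xu; apply: NNPP => nomatch.
have sep y : y \in succs v -> ~ indistinguishable ext x y.
  by move=> yv xy; apply: nomatch; exists y.
(* Some formula exists: an atom, or, when every state has a successor, a formula separating [x] from
   a successor of [v]. *)
have [phi0 _] : exists phi0 : form (AP K) ext, True.
  case: hK => [/card_gt0P [p _]|serial]; first by exists (Atom ext p).
  have [y vy] := serial v; have [|phi _] := @separating_formula x y.
    by apply: sep; rewrite inE.
  by exists phi.
have [|phi [xphi sphi]] := @separating_formula_seq x (enum (succs v)) phi0.
  by move=> y; rewrite mem_enum; apply: sep.
have /(uv (EX phi)) [y [yv yphi]] : sat u (EX phi) by exists x.
by apply: (sphi y); rewrite // mem_enum.
Qed.

Lemma indistinguishable_bisimulation :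
  (0 < #|AP K| \/ forall u : K, exists v : K, trans u v) ->
  bisimulation (@indistinguishable K ext).
Proof.
move=> hK u v uv; split=> [|x|y].
- by apply/setP => p; apply/idP/idP => /(uv (Atom ext p)).
- exact: indistinguishable_succ.
- move/(indistinguishable_succ hK (indistinguishable_sym uv)) => [x xu yx].
  by exists x => //; apply: indistinguishable_sym.
Qed.

Lemma indistinguishable_bisimilar u v :
  (0 < #|AP K| \/ forall u : K, exists v : K, trans u v) ->
  indistinguishable ext u v <-> bisimilar u v.
Proof.
move=> hK; split=> [uv|[B [bisB Buv]]]; last exact: bisimulation_indistinguishable Buv.
by exists (@indistinguishable K ext); split=> //;
  apply: indistinguishable_bisimulation.
Qed.

End Characterization.

(** [hK] excludes structures with no atoms and a dead end: there the syntax is empty, so all states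
    are indistinguishable, yet a dead end is not bisimilar to a state with a successor. *)
Theorem theorem4 (K : kripke)
    (hK : 0 < #|AP K| \/ forall u : K, exists v : K, trans u v)
    (t t' : K) :
  ((forall phi : CTLSync (AP K), sat t phi <-> sat t' phi)
     <-> bisimilar t t') /\
  ((forall phi : CTLSyncSeq (AP K), sat t phi <-> sat t' phi)
     <-> bisimilar t t').
(* The argument is uniform in [ext]; the two equivalences are its instances at [false] and
   [true]. *)
Proof. by split; apply: indistinguishable_bisimilar. Qed.
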